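(* For every $t\ge0$, every $\alpha\ge1$ and every $f\in F_0(G)$, the interacting particle system started from $f$ satisfies $\mathbb E_f\|f_t\|_\alpha^\alpha<\infty$.
   Context: A graph is a quadruple $G=(V,E,K,m)$: $V$ is a finite or countable set of nodes, which are elements of a real Hilbert space $\mathcal H$ with inner product ''$\cdot$'' and norm $|\cdot|$; $E$ is a set of undirected edges (at most one edge between any two distinct nodes, no self-loops); the edge between $x$ and $y$ is written $\langle x,y\rangle=\langle y,x\rangle$, and $y\sim x$ means this edge exists; $K=(k_{xy})_{x,y\in V}$ with $k_{xy}=k_{yx}\ge0$ and $k_{xy}=0$ if there is no edge; $m=(m_x)_{x\in V}$ with $m_x>0$. Let $e_{xy}=(y-x)/|y-x|$. Assume $d_0=\sup_{x\in V}\#\{y:y\sim x\}<\infty$, set $d=\max\{d_0,2\}$, and assume $M=\max\{\sup_{x\in V}m_x^{-1},\sup_{\langle x,y\rangle\in E}k_{xy}\}<\infty$. $V=V_0\cup V_1$ is a fixed partition into disjoint sets. $F(G)$ is the set of functions $f$ assigning a real number $f(x)$ to each $x\in V$ and a vector $f(\langle x,y\rangle)\in\mathcal H$ that is a real multiple of $y-x$ to each edge. For $1\le\alpha<\infty$, $\|f\|_\alpha=\big(\sum_{x\in V}|f(x)|^\alpha/m_x+\sum_{\langle x,y\rangle\in E}k_{xy}|f(\langle x,y\rangle)|^\alpha\big)^{1/\alpha}$, and $\|f\|_\infty=\max\{\sup_x|f(x)|,\sup_{\langle x,y\rangle}|f(\langle x,y\rangle)|\}$. $F_0(G)$ is the set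 of $f\in F(G)$ with finitely many nonzero values such that $|f(x)|\in\mathbb Z$ and $|f(\langle x,y\rangle)|\in\mathbb Z$ for all nodes and edges. The interacting particle system (IPS) $(f_t)_{t\ge0}$ is the continuous-time Markov jump process on $F_0(G)$ with the following transitions from state $f$: (i) for each $x\in V$, at rate $|f(x)|/m_x$, for every $y\sim x$ the edge value $f(\langle x,y\rangle)$ is replaced by $f(\langle x,y\rangle)+\mathrm{sgn}(f(x))\,e_{yx}$ (all other values unchanged); (ii) for each edge $\langle x,y\rangle$, at rate $k_{xy}|f(\langle x,y\rangle)|$, with $s=\mathrm{sgn}(f(\langle x,y\rangle)\cdot e_{xy})$, the value $f(x)$ is replaced by $f(x)+s$ if $x\in V_0$ and $f(y)$ by $f(y)-s$ if $y\in V_0$ (values at nodes of $V_1$ never change; this rule is symmetric in $x,y$). $P_f,\mathbb E_f$ denote probability and expectation given $f_0=f$. $\tau_0=0$, $\tau_n$ is the time of the $n$-th jump, $\xi_n=\tau_n-\tau_{n-1}$, $h_n=f_{\tau_n}$, and $\eta_t=\sup\{n:\tau_n\le t\}$. *)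

(* Defs.v *)
From HB Require Import structures.
From mathcomp Require Import all_boot all_order all_algebra.
From mathcomp Require Import all_classical all_reals all_analysis.
From mathcomp Require Import measurable_realfun lebesgue_integral.
Set Implicit Arguments. Unset Strict Implicit. Unset Printing Implicit Defensive.
Import Order.TTheory GRing.Theory Num.Theory.
Local Open Scope classical_set_scope.
Local Open Scope ring_scope.

(* Graph encoding:
   - V : countType  = nodes;  E : countType = (undirected) edges, each edge e
     is given with a fixed (arbitrary) orientation  <src e, dst e>.
   - A state f in F(G) is a pair  (node values : V -> int, edge coefficients : E -> int)
     where the vector edge value is  f(<src e,dst e>) = (f.2 e) * e_{src e, dst e};
     this is a bijective encoding of "a real multiple of y-x of integer norm",
     and |f(<x,y>)| = |f.2 e|,  sgn(f(<x,y>) . e_{xy}) = sgz (f.2 e) for x = src e. *)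

Definition state (V E : Type) := ((V -> int) * (E -> int))%type.

(* F_0(G): finitely many nonzero values (integrality is built into the type) *)
Definition F0 (V E : Type) (g : state V E) : Prop :=
  finite_set [set x | g.1 x != 0] /\ finite_set [set e | g.2 e != 0].

Section Moves.
Context (V E : countType) (src dst : E -> V) (V0 : set V).

(* transition (i) at node x: for every y ~ x,
   f(<x,y>) <- f(<x,y>) + sgn(f(x)) e_{yx} *)
Definition node_move (x : V) (g : state V E) : state V E :=
  (g.1, fun e => g.2 e - sgz (g.1 x) * ((src e == x) : int)
                       + sgz (g.1 x) * ((dst e == x) : int)).

(* transition (ii) at edge e = <x,y>, x = src e, y = dst e:
   s = sgn(f(<x,y>) . e_{xy});  f(x) <- f(x)+s if x in V0;  f(y) <- f(y)-s if y in V0 *)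
Definition edge_move (e : E) (g : state V E) : state V E :=
  (fun z => g.1 z + sgz (g.2 e) * (((z == src e) && (z \in V0)) : int)
                  - sgz (g.2 e) * (((z == dst e) && (z \in V0)) : int),
   g.2).
End Moves.

Section Rates.
Context {R : realType} (V E : countType) (src dst : E -> V) (V0 : set V)
        (m : V -> R) (k : E -> R).

(* Q-matrix entry q(g,g') for g' <> g: total rate of the transitions leading from g to g' *)
Definition ips_rate (g g' : state V E) : R :=
  (\sum_(x \in [set x | node_move src dst x g = g']) (`|g.1 x|%:~R / m x))%R
  + (\sum_(e \in [set e | edge_move src dst V0 e g = g']) (k e * `|g.2 e|%:~R))%R.

(* total jump rate q(g) = sum over g' <> g of q(g,g') *)
Definition ips_qtot (g : state V E) : R :=
  (\sum_(x \in [set x | node_move src dst x g <> g]) (`|g.1 x|%:~R / m x))%R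
  + (\sum_(e \in [set e | edge_move src dst V0 e g <> g]) (k e * `|g.2 e|%:~R))%R.

Definition ips_jump (g g' : state V E) : R :=
  if ips_qtot g == 0 then (`[< g' = g >])%:R
  else if `[< g' = g >] then 0 else ips_rate g g' / ips_qtot g.

Definition ips_normp (alpha : R) (g : state V E) : R :=
  (\sum_(x \in [set: V]) ((`|g.1 x|%:~R `^ alpha) / m x))%R
  + (\sum_(e \in [set: E]) (k e * (`|g.2 e|%:~R `^ alpha)))%R.
End Rates.

Definition jump_time {R : realType} (Omega : Type) (xi : nat -> Omega -> \bar R)
  (n : nat) (w : Omega) : \bar R :=
  (\sum_(1 <= i < n.+1) xi i w)%E.

(* the value of the observable g |-> ||g||_alpha^alpha at f_t = h_{eta_t},
   eta_t = sup {n | tau_n <= t};  +oo if eta_t = +oo (explosion before t) *)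
Definition ips_normp_at {R : realType} (V E : countType) (Omega : Type)
  (h : nat -> Omega -> state V E) (xi : nat -> Omega -> \bar R)
  (normp : state V E -> R) (t : R) (w : Omega) : \bar R :=
  match pselect (exists n : nat, (jump_time xi n w <= t%:E)%E /\
                  forall n', (jump_time xi n' w <= t%:E)%E -> (n' <= n)%N) with
  | left H => (normp (h (proj1_sig (cid H)) w))%:E
  | right _ => +oo%E
  end.

(* (h_n, xi_n) is the jump chain / holding times of the IPS started at f:
   for all n, g_0..g_n, s_1..s_n >= 0,
   P(h_i = g_i (i <= n), xi_i > s_i (1 <= i <= n))
     = [g_0 = f] prod_{i=1}^n pi(g_{i-1},g_i) exp(-q(g_{i-1}) s_i). *)
Definition is_IPS {R : realType} (V E : countType) (src dst : E -> V) (V0 : set V)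
  (m : V -> R) (k : E -> R) (d : measure_display) (Omega : measurableType d)
  (P : probability Omega R) (f : state V E)
  (h : nat -> Omega -> state V E) (xi : nat -> Omega -> \bar R) : Prop :=
  (forall n g, measurable [set w | h n w = g]) /\
  (forall n, measurable_fun setT (xi n)) /\
  (forall (n : nat) (g : nat -> state V E) (s : nat -> R),
     (forall i, 0 <= s i) ->
     P [set w | (forall i, (i <= n)%N -> h i w = g i) /\
                (forall i, (1 <= i <= n)%N -> ((s i)%:E < xi i w)%E)]
     = ((`[< g 0%N = f >])%:R *
        \prod_(1 <= i < n.+1)
           (ips_jump src dst V0 m k (g i.-1) (g i)
            * expR (- ips_qtot src dst V0 m k (g i.-1) * s i)))%:E).

(* Main.v *)
Require Import Defs.
From HB Require Import structures.
From mathcomp Require Import all_boot all_order all_algebra.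
From mathcomp Require Import all_classical all_reals all_analysis.
From mathcomp Require Import measurable_realfun lebesgue_integral.
From mathcomp Require Import zify ring lra.
Import Order.TTheory GRing.Theory Num.Theory.
Local Open Scope classical_set_scope.
Local Open Scope ring_scope.

Set Implicit Arguments.
Unset Strict Implicit.
Unset Printing Implicit Defensive.

(** Let [S] be the sum of the absolute values of all node and edge values. One
    jump increases [S] by at most a constant [c], so after [n] jumps [S] is at
    most [S_0 + c n]: the holding rates grow at most linearly in [n], and
    [||.||_alpha^alpha] at most polynomially. It remains to see that the number
    of jumps before time [t] has all moments. By a Chernoff bound,
    [P (tau_n <= t) <= expR (theta t) * \prod_(i <= n) rho_i], where [rho_i]
    bounds the conditional mean of a two-valued function above
    [expR (- theta xi_i)]. As the rates are linear in [i], for every [r] a large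
    [theta] gives [rho_i <= (1 - 1 / (i + N + 1)) ^ r], hence
    [P (tau_n <= t) = O (n ^ - r)]. Two-valued functions suffice, so only the
    tail probabilities of the holding times enter, and no densities. *)

(** * Cylinder events of a jump chain with holding times, and their probabilities *)

Definition update {T : Type} (g : nat -> T) (j : nat) (x : T) (i : nat) : T :=
  if i == j then x else g i.

Lemma update_eq {T : Type} (g : nat -> T) j x : update g j x j = x.
Proof. by rewrite /update eqxx. Qed.

Lemma update_neq {T : Type} (g : nat -> T) j x i :
  i != j -> update g j x i = g i.
Proof. by rewrite /update => /negbTE ->. Qed.

Lemma updateS_le {T : Type} (g : nat -> T) n x i :
  (i <= n)%N -> update g n.+1 x i = g i.
Proof. by move=> le_in; rewrite update_neq// ltn_eqF// ltnS. Qed.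

Section JumpChain.
Context {R : realType} {T : choiceType} {d : measure_display}
  {Omega : measurableType d} (P : probability Omega R).
Context (f : T) (pi : T -> T -> R) (q : T -> R).
Context (h : nat -> Omega -> T) (xi : nat -> Omega -> \bar R).

(** [is_IPS] with state space, jump kernel and rates left abstract; for the kernel and rates of the
    IPS both unfold to the same statement. *)
Definition jump_law : Prop :=
  (forall n g, measurable [set w | h n w = g]) /\
  (forall n, measurable_fun setT (xi n)) /\
  (forall (n : nat) (g : nat -> T) (s : nat -> R),
     (forall i, 0 <= s i) ->
     P [set w | (forall i, (i <= n)%N -> h i w = g i) /\
                (forall i, (1 <= i <= n)%N -> ((s i)%:E < xi i w)%E)]
     = ((`[< g 0%N = f >])%:R *
        \prod_(1 <= i < n.+1)
           (pi (g i.-1) (g i) * expR (- q (g i.-1) * s i)))%:E).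

(** For [s >= 0] the two slots partition the positive times. Excluding times at most 0 makes the
    bounded slot a difference of two tails at nonnegative levels, the only events whose law is
    given. *)
Definition slot (b : bool) (s : R) : set (\bar R) :=
  if b then [set x | s%:E < x]%E else [set x | (0 < x)%E /\ (x <= s%:E)%E].

Definition slot_prob (b : bool) (s r : R) : R :=
  if b then expR (- r * s) else 1 - expR (- r * s).

Definition cyl (n : nat) (g : nat -> T) (b : nat -> bool) (s : nat -> R) :
    set Omega :=
  [set w | (forall i, (i <= n)%N -> h i w = g i) /\
           (forall i, (1 <= i <= n)%N -> slot (b i) (s i) (xi i w))].

Hypothesis law : jump_law.

Lemma measurable_slot b s i : measurable [set w | slot b s (xi i w)].
Proof.
have mxi := law.2.1 i.
case: b => /=; rewrite -[X in measurable X]setTI.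
  exact: emeasurable_fun_o_infty.
rewrite (_ : [set w | _] = [set w | 0 < xi i w]%E `&` [set w | xi i w <= s%:E]%E)//.
rewrite setTI; apply: measurableI; rewrite -[X in measurable X]setTI.
  exact: emeasurable_fun_o_infty.
exact: emeasurable_fun_infty_c.
Qed.

Lemma measurable_cyl n g b s : measurable (cyl n g b s).
Proof.
rewrite (_ : cyl n g b s =
  (\bigcap_i [set w | (i <= n)%N -> h i w = g i]) `&`
  (\bigcap_i [set w | (1 <= i <= n)%N -> slot (b i) (s i) (xi i w)])); last first.
  apply/seteqP; split=> w [hg hs]; first by split=> i _; [exact: hg|exact: hs].
  by split=> i; [exact: (hg i I)|exact: (hs i I)].
apply: measurableI; apply: bigcapT_measurable => i.
  case: (i <= n)%N; last by rewrite (_ : [set _ | _] = setT)//; apply/seteqP.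
  rewrite (_ : [set _ | _] = [set w | h i w = g i]); first exact: law.1.
  by apply/seteqP; split=> w /=; [exact|move=> ->].
case: (1 <= i <= n)%N; last by rewrite (_ : [set _ | _] = setT)//; apply/seteqP.
rewrite (_ : [set _ | _] = [set w | slot (b i) (s i) (xi i w)]).
  exact: measurable_slot.
by apply/seteqP; split=> w /=; [exact|move=> ? _].
Qed.

Definition cyl_weight n (g : nat -> T) (b : nat -> bool) (s : nat -> R) : R :=
  (`[< g 0%N = f >])%:R * \prod_(1 <= i < n.+1)
    (pi (g i.-1) (g i) * slot_prob (b i) (s i) (q (g i.-1))).

Lemma prod_nat_D1 (F : nat -> R) j n : (1 <= j <= n)%N ->
  \prod_(1 <= i < n.+1) F i = F j * \prod_(1 <= i < n.+1 | i != j) F i.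
Proof.
by move=> jn; rewrite (bigD1_seq j)/= ?iota_uniq// mem_index_iota ltnS.
Qed.

(* A bounded slot is the difference of two unbounded ones, so the law of the
   cylinders follows from the law of the tails one slot at a time. *)
Lemma prob_cyl n g b s : (forall i, 0 <= s i) ->
  P (cyl n g b s) = (cyl_weight n g b s)%:E.
Proof.
move=> s_ge0.
(* Bounded slots occur only at positions up to [j]; for [j = 0] the event is one of those in
   [jump_law]. *)
suff aux j : forall b s, (forall i, 0 <= s i) ->
    (forall i, (j < i <= n)%N -> b i = true) ->
    P (cyl n g b s) = (cyl_weight n g b s)%:E.
  by apply: (aux n) => // i; rewrite ltnNge andNb.
elim: j => [|j IH] {b s s_ge0} b s s_ge0 bT.
  have -> : cyl_weight n g b s = (`[< g 0%N = f >])%:R *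
      \prod_(1 <= i < n.+1) (pi (g i.-1) (g i) * expR (- q (g i.-1) * s i)).
    congr (_ * _); apply: eq_big_nat => i ilt.
    by rewrite bT.
  rewrite -(law.2.2 n g s s_ge0); congr (P _).
  apply/seteqP; split=> w [hg hs]; split=> // i ilt; have := hs i ilt;
    by rewrite /slot /= bT.
have [bj|/negbTE bj] := boolP (b j.+1).
  apply: IH => // i /andP[ji ilen].
  by move: ji; rewrite leq_eqVlt => /predU1P[<-//|ji]; apply: bT; rewrite ji.
have [nj|jn] := ltnP n j.+1.
  apply: IH => // i /andP[ji ilen].
  by have := leq_trans ji ilen; rewrite leqNgt nj.
pose b' := update b j.+1 true; pose s' := update s j.+1 0.
have s'_ge0 i : 0 <= s' i by rewrite /s' /update; case: ifP.
have b'T i : (j < i <= n)%N -> b' i = true.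
  rewrite /b' /update; case: eqP => // /eqP ij /andP[ji ilen]; apply: bT.
  by rewrite ilen andbT ltn_neqAle eq_sym ij.
have -> : cyl n g b s = cyl n g b' s' `\` cyl n g b' s.
  apply/seteqP; split=> w.
    move=> [hg hs]; split.
      split=> // i ilt; have := hs i ilt; rewrite /b' /s' /update.
      by case: eqP => // ->; rewrite bj => -[].
    move=> [_ /(_ j.+1)]; have := hs j.+1.
    rewrite /= jn /b' update_eq bj => /(_ erefl)[_ xis] /(_ erefl) /=.
    by rewrite ltNge xis.
  move=> [[hg hs] ncyl]; split=> // i ilt.
  have [ij|ij] := eqVneq i j.+1; last first.
    by have := hs i ilt; rewrite /b' /s' !update_neq.
  rewrite ij bj; have := hs i ilt; rewrite ij /b' /s' !update_eq /= => xi0.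
  split=> //; rewrite leNgt; apply/negP => sxi; apply: ncyl; split=> // k klt.
  have [->|kj] := eqVneq k j.+1; first by rewrite /b' update_eq.
  by have := hs k klt; rewrite /b' /s' !update_neq.
have subAB : cyl n g b' s `<=` cyl n g b' s'.
  move=> w [hg hs]; split=> // i ilt; have := hs i ilt; rewrite /b' /s' /update.
  by case: eqP => // ij /=; apply: le_lt_trans; rewrite lee_fin.
rewrite measureD; [|exact: measurable_cyl|exact: measurable_cyl|]; last first.
  by rewrite (le_lt_trans (probability_le1 _ _))// ?ltry//; exact: measurable_cyl.
have -> : cyl n g b' s' `&` cyl n g b' s = cyl n g b' s by apply/setIidPr.
transitivity ((cyl_weight n g b' s')%:E - (cyl_weight n g b' s)%:E)%E.
  by congr (_ - _)%E; apply: IH.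
rewrite -EFinB; congr EFin.
have jn1 : (1 <= j.+1 <= n)%N by [].
rewrite /cyl_weight !(prod_nat_D1 _ jn1) /b' /s' !update_eq bj /slot_prob.
under eq_bigr => i ij do rewrite !update_neq//.
under [X in _ - _ * (_ * X)]eq_bigr => i ij do rewrite !update_neq//.
rewrite mulr0 expR0; lra.
Qed.

Lemma cyl_weightS n g b s x c :
  cyl_weight n.+1 (update g n.+1 x) (update b n.+1 c) s =
  cyl_weight n g b s * (pi (g n) x * slot_prob c (s n.+1) (q (g n))).
Proof.
rewrite /cyl_weight big_nat_recr//= mulrA updateS_le// !update_eq updateS_le//.
congr (_ * _ * _); apply: eq_big_nat => i /andP[i1 ilt].
by rewrite !updateS_le// (leq_trans (leq_pred _)).
Qed.

End JumpChain.

(** * One-step branching, almost sure invariants and the Chernoff bound *)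

Section Tail.
Context {R : realType} {T : choiceType} {d : measure_display}
  {Omega : measurableType d} (P : probability Omega R).
Context (f : T) (pi : T -> T -> R) (q : T -> R).
Context (h : nat -> Omega -> T) (xi : nat -> Omega -> \bar R).
Hypothesis law : jump_law P f pi q h xi.
(** [succ g] is a finite list carrying the whole jump law from [g], and [inv n] a property
    propagated to the states after [n] jumps. *)
Context (succ : T -> seq T) (inv : nat -> T -> Prop).
Hypothesis inv0 : inv 0 f.
Hypothesis invS : forall n g g', inv n g -> g' \in succ g -> inv n.+1 g'.
Hypothesis uniq_succ : forall g, uniq (succ g).
Hypothesis sum_pi : forall n g, inv n g -> \sum_(x <- succ g) pi g x = 1.
Context (s : nat -> R).
Hypothesis s_ge0 : forall i, 0 <= s i.

Let cyl n g b := cyl h xi n g b s.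
Let W n g b := cyl_weight f pi q n g b s.

Let mcyl n g b : measurable (cyl n g b).
Proof. exact: measurable_cyl law _ _ _ _. Qed.

Let Pcyl n g b : P (cyl n g b) = (W n g b)%:E.
Proof. exact: prob_cyl. Qed.

Let next n g b x c := cyl n.+1 (update g n.+1 x) (update b n.+1 c).

Let W_ge0 n g b : 0 <= W n g b.
Proof. by rewrite -lee_fin -Pcyl. Qed.

Lemma cyl_next_sub n g b x c : next n g b x c `<=` cyl n g b.
Proof.
move=> w [hg hs]; split=> i.
  by move=> le_in; have := hg i (leqW le_in); rewrite updateS_le.
move=> /andP[i1 le_in]; have := hs i; rewrite i1 (leqW le_in) => /(_ erefl).
by rewrite updateS_le.
Qed.

Lemma cyl_next_h n g b x c w : next n g b x c w -> h n.+1 w = x.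
Proof. by move=> [/(_ n.+1 (leqnn _)) -> _]; rewrite update_eq. Qed.

Let branch n g b x := next n g b x true `|` next n g b x false.

Lemma cyl_branch_disj n g b (A : set T) : trivIset A (branch n g b).
Proof.
by apply/trivIsetP => x y _ _ xy; apply/seteqP; split=> // w [];
  case=> /cyl_next_h hx []/cyl_next_h hy; case/eqP: xy; rewrite -hx -hy.
Qed.

(** The probabilities of the two slots add up to 1, so only the jump probability remains. *)
Lemma prob_branch n g b x : P (branch n g b x) = (W n g b * pi (g n) x)%:E.
Proof.
rewrite measureU; [|exact: mcyl|exact: mcyl|]; last first.
  apply/seteqP; split=> // w [[_ /(_ n.+1)] + [_ /(_ n.+1)]].
  rewrite leqnn => /(_ erefl) + /(_ erefl).
  by rewrite !update_eq /= => + [_]; rewrite ltNge => /negP.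
transitivity ((W n.+1 (update g n.+1 x) (update b n.+1 true))%:E +
              (W n.+1 (update g n.+1 x) (update b n.+1 false))%:E)%E.
  by congr (_ + _)%E; apply: Pcyl.
rewrite -EFinD; congr EFin; rewrite /W !cyl_weightS /slot_prob; lra.
Qed.

Let U n g b := \bigcup_(x in [set` succ (g n)]) branch n g b x.

Let mbranch n g b x : measurable (branch n g b x).
Proof. by apply: measurableU; exact: mcyl. Qed.

Let mU n g b : measurable (U n g b).
Proof. by rewrite /U bigcup_seq; apply: bigsetU_measurable. Qed.

(** The jump probabilities over [succ (g n)] sum to 1, so the disjoint branches already have the
    full probability of the cylinder. *)
Lemma cyl_step_null n g b : inv n (g n) -> P (cyl n g b `\` U n g b) = 0%E.
Proof.
move=> invg; rewrite measureD; [|exact: mcyl|exact: mU|]; last first.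
  by rewrite (le_lt_trans (probability_le1 _ _))// ?ltry//; exact: mcyl.
have -> : cyl n g b `&` U n g b = U n g b.
  by apply/setIidPr => w [x _ []]; exact: cyl_next_sub.
transitivity ((W n g b)%:E - (W n g b)%:E)%E; last by rewrite subee.
congr (_ - _)%E; first exact: Pcyl.
rewrite measure_fin_bigcup//; last exact: cyl_branch_disj.
rewrite -fsbig_seq//.
transitivity (\sum_(x <- succ (g n)) (W n g b * pi (g n) x)%:E)%E.
  by apply: eq_bigr => x _; exact: prob_branch.
by rewrite sumEFin -mulr_sumr (sum_pi invg) mulr1.
Qed.

Lemma prob_cyl_step n g b (B : set Omega) : inv n (g n) -> measurable B ->
  (P (cyl n g b `&` B) <= \sum_(x <- succ (g n))
    (P (next n g b x true `&` B) + P (next n g b x false `&` B)))%E.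
Proof.
move=> invg mB.
apply: (@le_trans _ _ (P ((cyl n g b `\` U n g b) `|`
    \bigcup_(x in [set` succ (g n)]) (branch n g b x `&` B)))).
  apply: le_measure; rewrite ?inE.
  - by apply: measurableI => //; exact: mcyl.
  - apply: measurableU; first by apply: measurableD; [exact: mcyl|exact: mU].
    by rewrite bigcup_seq; apply: bigsetU_measurable => x _; apply: measurableI.
  - move=> w [cw Bw]; have [[x sx bx]|nU] := pselect (U n g b w); last by left.
    by right; exists x.
have mUB : measurable (\bigcup_(x in [set` succ (g n)]) (branch n g b x `&` B)).
  by rewrite bigcup_seq; apply: bigsetU_measurable => x _; apply: measurableI.
apply: le_trans (measureU2 _ _ mUB) _.
  by apply: measurableD; [exact: mcyl|exact: mU].
rewrite [X in (X + _)%E](cyl_step_null b invg) add0e.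
rewrite measure_fin_bigcup//.
- rewrite -fsbig_seq//; apply: lee_sum => x _.
  by rewrite /branch setIUl; apply: measureU2; apply: measurableI => //; exact: mcyl.
- by apply: trivIset_setIr; exact: cyl_branch_disj.
- by move=> x _; apply: measurableI.
Qed.

(** Induction on the number [k] of remaining jumps over all cylinders. Negligibility is the right
    notion because [inv] need not define a measurable event. *)
Lemma inv_ae_from k : forall n g b, inv n (g n) ->
  P.-negligible (cyl n g b `&` [set w | ~ inv (n + k) (h (n + k) w)]).
Proof.
elim: k => [|k IH] n g b invg.
  rewrite addn0 (_ : _ `&` _ = set0); first exact: negligible_set0.
  by apply/seteqP; split=> // w [[/(_ n (leqnn n)) hn _]] /=; rewrite hn.
rewrite addnS -addSn.
apply: (@negligibleS _ _ _ P ((cyl n g b `\` U n g b) `|`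
    \big[setU/set0]_(x <- succ (g n) | x \in succ (g n))
      ((next n g b x true `&` [set w | ~ inv (n.+1 + k) (h (n.+1 + k) w)]) `|`
       (next n g b x false `&` [set w | ~ inv (n.+1 + k) (h (n.+1 + k) w)])))).
  move=> w [cw Bw]; have [[x sx bx]|nU] := pselect (U n g b w); last by left.
  right; rewrite -big_seq -bigcup_seq; exists x => //.
  by case: bx => bx; [left|right].
apply: negligibleU.
  exists (cyl n g b `\` U n g b); split => //; last exact: cyl_step_null.
  by apply: measurableD; [exact: mcyl|exact: mU].
elim/big_ind: _ => [||x sx]; [exact: negligible_set0|exact: negligibleU|].
by apply: negligibleU; apply: IH; rewrite update_eq; exact: invS sx.
Qed.

Let cyl0_null : P.-negligible (~` cyl 0 (fun=> f) (fun=> true)).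
Proof.
exists (~` cyl 0 (fun=> f) (fun=> true)); split => //.
  by apply: measurableC; exact: mcyl.
rewrite probability_setC; last exact: mcyl.
rewrite [X in (_ - X)%E](Pcyl 0 (fun=> f) (fun=> true)).
rewrite /W /cyl_weight big_geq// mulr1; case: asboolP => //= _.
by rewrite subee.
Qed.

Lemma inv_ae : P.-negligible [set w | ~ forall n, inv n (h n w)].
Proof.
apply: (@negligibleS _ _ _ P (~` cyl 0 (fun=> f) (fun=> true) `|`
  \bigcup_n (cyl 0 (fun=> f) (fun=> true) `&` [set w | ~ inv n (h n w)]))).
  move=> w /existsNP[n ninv].
  have [c|nc] := pselect (cyl 0 (fun=> f) (fun=> true) w); last by left.
  by right; exists n.
apply: negligibleU => //; apply: negligible_bigcup => n.
by have := @inv_ae_from n 0 (fun=> f) (fun=> true) inv0; rewrite add0n.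
Qed.

Context (theta t : R) (rho : nat -> R).
Hypothesis theta_ge0 : 0 <= theta.
(** For an exponential time of rate [q g], the left side is the mean of the function equal to 1 up
    to the threshold [s n.+1] and to [expR (- theta * s n.+1)] beyond it. *)
Hypothesis rho_ge : forall n g, inv n g ->
  1 - (1 - expR (- theta * s n.+1)) * expR (- q g * s n.+1) <= rho n.+1.
Hypothesis rho_ge0 : forall i, 0 <= rho i.

(** The lower bound for [jump_time] that the slots reveal: an unbounded slot contributes its
    threshold, a bounded one 0. *)
Let elapsed n (b : nat -> bool) := \sum_(1 <= i < n.+1) (if b i then s i else 0).

Let tauset n := [set w | (jump_time xi n w <= t%:E)%E].

Lemma measurable_jump_time n : measurable_fun setT (jump_time xi n).
Proof. by apply: emeasurable_sum => i; exact: law.2.1. Qed.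

Lemma measurable_jump_time_le n : measurable (tauset n).
Proof.
rewrite -[X in measurable X]setTI.
by apply: emeasurable_fun_infty_c => //; exact: measurable_jump_time.
Qed.

Lemma elapsed_le n g b w : cyl n g b w -> tauset n w -> elapsed n b <= t.
Proof.
move=> [_ hs]; rewrite /tauset /= => tau; rewrite -lee_fin.
apply: le_trans tau; rewrite /jump_time /elapsed -sumEFin.
rewrite big_nat_cond [leRHS]big_nat_cond; apply: lee_sum => i.
rewrite andbT => /andP[i1 ile].
have := hs i; rewrite i1 -ltnS ile => /(_ erefl).
by case: (b i) => /= [/ltW//|[/ltW//]].
Qed.

(* A Chernoff bound for the sum of the holding times: every step multiplies the
   bound by the conditional mean of a step function dominating
   [expR (- theta * xi)] on positive holding times. *)
Lemma tail_from k : forall n g b, inv n (g n) ->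
  (P (cyl n g b `&` tauset (n + k)) <= (W n g b *
    (expR (theta * (t - elapsed n b)) * \prod_(n.+1 <= i < (n + k).+1) rho i))%:E)%E.
Proof.
elim: k => [|k IH] n g b invg.
  rewrite addn0 big_geq// mulr1.
  (* With no jump left, the exponential factor is at least 1 if [elapsed n b <= t]; otherwise the
     event is empty. *)
  have [el|el] := leP (elapsed n b) t.
    apply: (@le_trans _ _ (P (cyl n g b))).
      apply: le_measure; rewrite ?inE; [|exact: mcyl|exact: subIsetl].
      by apply: measurableI; [exact: mcyl|exact: measurable_jump_time_le].
    rewrite [leLHS]Pcyl lee_fin ler_peMr// -expR0 ler_expR mulr_ge0// subr_ge0//.
  rewrite (_ : _ `&` _ = set0); last first.
    by apply/seteqP; split=> // w [cw tw]; have := elapsed_le cw tw; rewrite leNgt el.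
  by rewrite measure0 lee_fin mulr_ge0// expR_ge0.
rewrite addnS -addSn.
apply: le_trans (prob_cyl_step b invg (measurable_jump_time_le _)) _.
set Q := \prod_(n.+2 <= i < (n.+1 + k).+1) rho i.
have Q_ge0 : 0 <= Q by apply: prodr_ge0.
set e := expR (theta * (t - elapsed n b)).
set a := expR (- theta * s n.+1); set c := expR (- q (g n) * s n.+1).
apply: (@le_trans _ _ (\sum_(x <- succ (g n))
    (W n g b * pi (g n) x * (e * Q * (1 - (1 - a) * c)))%:E)%E).
  rewrite big_seq [leRHS]big_seq; apply: lee_sum => x sx.
  have invx : inv n.+1 (update g n.+1 x n.+1) by rewrite update_eq; exact: invS sx.
  have PT := IH n.+1 _ (update b n.+1 true) invx.
  have PF := IH n.+1 _ (update b n.+1 false) invx.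
  apply: le_trans; first by apply: leeD; [exact: PT|exact: PF].
  rewrite -EFinD lee_fin /W !cyl_weightS -/(W n g b) /slot_prob -/c -/Q.
  (* The unbounded slot, of weight [c], lengthens [elapsed] and yields the factor [a]; the bounded
     one, of weight [1 - c], yields the factor 1. *)
  have elS z : elapsed n.+1 (update b n.+1 z) =
      elapsed n b + (if z then s n.+1 else 0).
    rewrite /elapsed big_nat_recr//= update_eq; congr (_ + _).
    by apply: eq_big_nat => i /andP[_ ilt]; rewrite updateS_le.
  rewrite !elS addr0 opprD addrA mulrDr expRD -/e mulrN -mulNr -/a.
  lra.
rewrite sumEFin lee_fin -mulr_suml -mulr_sumr (sum_pi invg) mulr1.
apply: ler_wpM2l => //; rewrite -mulrA; apply: ler_wpM2l; first exact: expR_ge0.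
rewrite [leRHS]big_ltn; last by rewrite ltnS leq_addr.
by rewrite -/Q mulrC ler_wpM2r//; exact: rho_ge.
Qed.

(** Apply [tail_from] to the cylinder of length 0 at [f], whose complement is null. *)
Lemma prob_jump_time_le n : (P (tauset n) <=
  (expR (theta * t) * \prod_(1 <= i < n.+1) rho i)%:E)%E.
Proof.
have [A [mA PA subA]] := cyl0_null.
apply: (@le_trans _ _ (P (A `|` (cyl 0 (fun=> f) (fun=> true) `&` tauset n)))).
  apply: le_measure; rewrite ?inE.
  - exact: measurable_jump_time_le.
  - apply: measurableU => //; apply: measurableI; first exact: mcyl.
    exact: measurable_jump_time_le.
  - move=> w tw; have [c|nc] := pselect (cyl 0 (fun=> f) (fun=> true) w).
      by right.
    by left; exact: subA.
apply: le_trans (measureU2 _ mA _) _.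
  by apply: measurableI; [exact: mcyl|exact: measurable_jump_time_le].
rewrite [X in (X + _)%E]PA add0e.
have := @tail_from n 0 (fun=> f) (fun=> true) inv0.
rewrite add0n => /le_trans; apply; rewrite lee_fin.
have -> : elapsed 0 (fun=> true) = 0 by rewrite /elapsed big_geq.
have -> : W 0 (fun=> f) (fun=> true) = 1.
  by rewrite /W /cyl_weight big_geq// mulr1; case: asboolP.
by rewrite mul1r subr0.
Qed.

End Tail.

(** * Auxiliary facts on integrals, series and elementary inequalities *)

(** The integral of a nonnegative function is a supremum over simple functions below it, hence
    monotone without measurability. This serves for [ips_normp_at], whose measurability is not
    established. *)
Lemma ge0_le_integral_nonmeas {R : realType} {d : measure_display}
  {T : measurableType d} (mu : {measure set T -> \bar R}) (u v : T -> \bar R) :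
  (forall x, 0 <= u x)%E -> (forall x, u x <= v x)%E ->
  (\int[mu]_x u x <= \int[mu]_x v x)%E.
Proof.
move=> u0 uv; rewrite !ge0_integralE//; last first.
  by move=> x _; exact: le_trans (uv x).
apply: le_ereal_sup => _ [g gu <-]; exists g => // x.
by apply: le_trans (gu x) _; rewrite !patch_setT.
Qed.

Lemma nneseries_ge1_infty {R : realType} (u : nat -> \bar R) :
  (forall n, 0 <= u n)%E -> (forall n, exists2 k, (n <= k)%N & (1 <= u k)%E) ->
  (\sum_(0 <= n <oo) u n)%E = +oo%E.
Proof.
move=> u0 u1.
have part K : exists k, (K%:R%:E <= \sum_(0 <= i < k) u i)%E.
  elim: K => [|K [k IH]]; first by exists 0%N; rewrite big_geq.
  have [j kj uj] := u1 k; exists j.+1.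
  rewrite big_nat_recr//= -natr1 EFinD; apply: leeD => //.
  apply: le_trans IH _; rewrite (big_cat_nat (leq0n k) kj)//= leeDl//.
  by apply: sume_ge0.
apply: eq_infty => r; have [k rk] := part (Num.trunc r).+1.
apply: le_trans (le_trans rk (nneseries_lim_ge k _)) => //.
by rewrite lee_fin ltW// truncnS_gt.
Qed.

Lemma Bernoulli_sub {R : realDomainType} (x : R) n : 0 <= x <= 1 ->
  1 - n%:R * x <= (1 - x) ^+ n.
Proof.
move=> /andP[x0 x1]; elim: n => [|n IH]; first by rewrite mul0r subr0 expr0.
rewrite exprS; apply: (@le_trans _ _ ((1 - x) * (1 - n%:R * x))).
  by rewrite -natr1; have := ler0n R n; nra.
by apply: ler_wpM2l; rewrite ?subr_ge0.
Qed.

Lemma prod_ratio {R : numFieldType} (N n : nat) :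
  \prod_(1 <= i < n.+1) ((i + N)%:R / (i + N).+1%:R) =
  N.+1%:R / (n + N).+1%:R :> R.
Proof.
elim: n => [|n IH]; first by rewrite big_geq// add0n divff.
by rewrite big_nat_recr//= IH addSn mulrA mulfVK.
Qed.

Lemma sum_inv_sqr_le {R : realFieldType} (k : nat) :
  \sum_(0 <= n < k) (n.+1%:R ^- 2) <= 2 :> R.
Proof.
(* The strengthened bound telescopes, as [2 / x - 2 / (x + 1) = 2 / (x * (x + 1))] is at least
   [x ^- 2] for [x >= 1]. *)
suff : \sum_(0 <= n < k) (n.+1%:R ^- 2) <= 2 - 2 / k.+1%:R :> R.
  by move=> /le_trans; apply; rewrite gerBl divr_ge0.
elim: k => [|k IH]; first by rewrite big_geq// divr1 subrr.
rewrite big_nat_recr//=; apply: le_trans (lerD IH (lexx _)) _.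
suff : k.+1%:R ^- 2 <= 2 / k.+1%:R - 2 / k.+2%:R :> R.
  by move: (k.+1%:R ^- 2) (2 / k.+1%:R) (2 / k.+2%:R) => a b c; lra.
rewrite -(natr1 k.+1); have : 1 <= k.+1%:R :> R by rewrite ler1n.
move: (k.+1%:R) => x x1; have x_gt0 : 0 < x by lra.
have -> : 2 / x - 2 / (x + 1) = 2 / (x * (x + 1)).
  by field; apply/andP; split; apply/eqP; lra.
rewrite expr2 ler_pdivlMr ?mulr_gt0 ?addr_gt0// mulrC invfM mulrACA.
by rewrite divff ?gt_eqF// mul1r ler_pdivrMr//; lra.
Qed.

(** With [kappa = 2 * r%:R * expR 1], [expR (- (kappa / y)) <= y / (y + kappa)]. The factor [expR 1]
    cancels the lower bound on [c], and the factor 2 absorbs [kappa <= y] in the denominator. What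
    remains is [1 - r / (y + 1)], to which Bernoulli's inequality applies. *)
Lemma step_factor_le {R : realType} (r : nat) (y c : R) :
  0 < y -> 2 * r%:R * expR 1 <= y -> expR (- 1) <= c ->
  1 - (1 - expR (- (2 * r%:R * expR 1 / y))) * c <= (y / (y + 1)) ^+ r.
Proof.
set kappa := 2 * r%:R * expR 1 => y_gt0 ky c_ge.
have kappa_ge0 : 0 <= kappa by rewrite !mulr_ge0// expR_ge0.
have yk : 0 < y + kappa by rewrite ltr_wpDr.
have y1 : 0 < y + 1 by rewrite addr_gt0.
have ex : expR (- (kappa / y)) <= y / (y + kappa).
  rewrite expRN -[leRHS]invrK lef_pV2 ?posrE ?expR_gt0 ?invr_gt0 ?divr_gt0//.
  by rewrite invf_div mulrDl divff ?gt_eqF//; exact: expR_ge1Dx.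
have -> : y / (y + 1) = 1 - (y + 1)^-1 by field; rewrite lt0r_neq0.
apply: le_trans; last first.
  by apply: Bernoulli_sub; rewrite invr_ge0 ltW//= invf_le1// lerDr ltW.
rewrite lerD2l lerN2.
apply: (@le_trans _ _ (kappa / (y + kappa) * expR (- 1))); last first.
  apply: ler_pM c_ge; [by rewrite divr_ge0// ltW|by rewrite expR_ge0|].
  rewrite lerBrDr -lerBrDl (le_trans ex)// le_eqVlt; apply/orP; left.
  by apply/eqP; field; rewrite lt0r_neq0.
have ke : kappa * expR (- 1) = 2 * r%:R.
  by rewrite /kappa -mulrA -expRD subrr expR0 mulr1.
rewrite [leRHS]mulrAC ke ler_pdivrMr// mulrAC ler_pdivlMr// [2 * _]mulrC -mulrA ler_wpM2l//.
by move: ky y_gt0; lra.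
Qed.

(** * Polynomial decay of the probability of many jumps *)

Section Moments.
Context {R : realType} {T : choiceType} {d : measure_display}
  {Omega : measurableType d} (P : probability Omega R).
Context (f : T) (pi : T -> T -> R) (q : T -> R).
Context (h : nat -> Omega -> T) (xi : nat -> Omega -> \bar R).
Hypothesis law : jump_law P f pi q h xi.
Context (succ : T -> seq T) (inv : nat -> T -> Prop).
Hypothesis inv0 : inv 0 f.
Hypothesis invS : forall n g g', inv n g -> g' \in succ g -> inv n.+1 g'.
Hypothesis uniq_succ : forall g, uniq (succ g).
Hypothesis sum_pi : forall n g, inv n g -> \sum_(x <- succ g) pi g x = 1.
Context (L : R).
Hypothesis L_gt0 : 0 < L.
Hypothesis q_le : forall n g, inv n g -> q g <= L * n.+1%:R.

(* The thresholds [s i] are of the order of the mean holding times, so that each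
   step contributes a factor [1 - r / (i + N).+1] or less once [theta] is large. *)
Lemma jump_time_tail (t : R) (r : nat) :
  exists2 C : R, 0 <= C & forall n,
    (P [set w | (jump_time xi n w <= t%:E)%E] <= (C / n.+1%:R ^+ r)%:E)%E.
Proof.
pose kappa : R := 2 * r%:R * expR 1.
have kappa_ge0 : 0 <= kappa by rewrite !mulr_ge0// expR_ge0.
(* The shift by [N] ensures [kappa <= i + N] from the first step on, as [step_factor_le]
   requires. *)
pose N := (Num.trunc kappa).+1.
have kappaN : kappa <= N%:R by rewrite ltW// truncnS_gt.
pose s i : R := (L * (i + N)%:R)^-1.
pose rho i : R := ((i + N)%:R / (i + N).+1%:R) ^+ r.
have s_ge0 i : 0 <= s i by rewrite invr_ge0 mulr_ge0// ltW.
have rho_ge0 i : 0 <= rho i by rewrite exprn_ge0// divr_ge0.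
have theta_ge0 : 0 <= L * kappa by rewrite mulr_ge0// ltW.
have rho_ge n g : inv n g ->
    1 - (1 - expR (- (L * kappa) * s n.+1)) * expR (- q g * s n.+1) <= rho n.+1.
  move=> invg; set y : R := (n.+1 + N)%:R.
  have y_gt0 : 0 < y by rewrite ltr0n addSn.
  have yN : N%:R <= y by rewrite ler_nat leq_addl.
  (* Hence the threshold is exceeded with conditional probability at least [expR (- 1)]. *)
  have qs : q g * s n.+1 <= 1.
    rewrite ler_pdivrMr ?mulr_gt0// mul1r (le_trans (q_le invg))//.
    by rewrite ler_pM2l// ler_nat leq_addr.
  have eq1 : expR (- 1) <= expR (- q g * s n.+1) by rewrite ler_expR mulNr lerN2.
  have ts : L * kappa * s n.+1 = kappa / y.
    by rewrite /s -/y invfM mulrACA divff ?gt_eqF// mul1r.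
  rewrite mulNr ts.
  by rewrite /rho -natr1; apply: step_factor_le => //; exact: le_trans yN.
pose C := expR (L * kappa * t) * N.+1%:R ^+ r.
exists C; first by rewrite mulr_ge0 ?expR_ge0 ?exprn_ge0.
move=> n; have := prob_jump_time_le law inv0 invS uniq_succ sum_pi s_ge0 t
  theta_ge0 rho_ge rho_ge0 n.
move=> /le_trans; apply; rewrite lee_fin prodrXl prod_ratio expr_div_n mulrA.
rewrite /C ler_wpM2l ?mulr_ge0 ?expR_ge0 ?exprn_ge0//.
rewrite lef_pV2 ?posrE ?exprn_gt0//.
by rewrite lerXn2r ?nnegrE// ler_nat ltnS leq_addr.
Qed.

End Moments.

(** * Integrability of polynomially growing observables *)

Section Integrability.
Context {R : realType} {V E : countType} {d : measure_display}
  {Omega : measurableType d} (P : probability Omega R).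
Context (f : state V E) (pi : state V E -> state V E -> R) (q : state V E -> R).
Context (h : nat -> Omega -> state V E) (xi : nat -> Omega -> \bar R).
Hypothesis law : jump_law P f pi q h xi.
Context (succ : state V E -> seq (state V E)) (inv : nat -> state V E -> Prop).
Hypothesis inv0 : inv 0 f.
Hypothesis invS : forall n g g', inv n g -> g' \in succ g -> inv n.+1 g'.
Hypothesis uniq_succ : forall g, uniq (succ g).
Hypothesis sum_pi : forall n g, inv n g -> \sum_(x <- succ g) pi g x = 1.
Context (L : R).
Hypothesis L_gt0 : 0 < L.
Hypothesis q_le : forall n g, inv n g -> q g <= L * n.+1%:R.

(* The observable at time [t] is dominated by the series of its bounds after [n]
   jumps over all [n] with [jump_time xi n <= t]; the series diverges on
   explosion, so its integrability also rules explosion out. *)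
Lemma integral_ips_normp_at_lty (normp : state V E -> R) (A t : R) (p : nat) :
  0 <= t -> 0 <= A -> (forall g, 0 <= normp g) ->
  (forall n g, inv n g -> normp g <= A * n.+1%:R ^+ p) ->
  (\int[P]_w ips_normp_at h xi normp t w < +oo)%E.
Proof.
move=> t_ge0 A_ge0 normp_ge0 normp_le.
have [B [mB PB subB]] := inv_ae law inv0 invS uniq_succ sum_pi (fun=> lexx 0).
(* Two powers more than the degree [p] of the observable leave the summable terms [n.+1 ^- 2]. *)
have [C C_ge0 tailC] := jump_time_tail law inv0 invS uniq_succ sum_pi L_gt0 q_le
  t p.+2.
(* The bounds on [normp] may fail on the null set [B]; adding it to every [D n] makes the dominating
   series infinite there at no cost in probability. *)
pose D n := [set w | (jump_time xi n w <= t%:E)%E] `|` B.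
have mtau n : measurable [set w | (jump_time xi n w <= t%:E)%E].
  exact: measurable_jump_time_le law t n.
have mD n : measurable (D n) by apply: measurableU.
have PD n : (P (D n) <= (C / n.+1%:R ^+ p.+2)%:E)%E.
  apply: le_trans (measureU2 _ (mtau n) mB) _.
  by rewrite [X in (_ + X)%E]PB adde0; exact: tailC.
(* The summand 1 keeps every term at least 1, so that infinitely many of them diverge even if
   [A = 0]. *)
pose a n : R := A * n.+1%:R ^+ p + 1.
have a_ge1 n : 1 <= a n by rewrite lerDr mulr_ge0// exprn_ge0.
have a_ge0 n : 0 <= a n by rewrite (le_trans ler01).
pose u n w : \bar R := ((a n)%:E * (\1_(D n) w)%:E)%E.
have u_ge0 n w : (0 <= u n w)%E.
  by rewrite /u -EFinM lee_fin mulr_ge0.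
have uD n w : D n w -> u n w = (a n)%:E.
  by move=> Dw; rewrite /u indicE mem_set// mule1.
apply: (@le_lt_trans _ _ (\int[P]_w \sum_(0 <= n <oo) u n w)%E).
  apply: ge0_le_integral_nonmeas => w; rewrite /ips_normp_at.
    by case: pselect => // H; rewrite lee_fin.
  have infty : (forall n, exists2 k, (n <= k)%N & D k w) ->
      (\sum_(0 <= n <oo) u n w)%E = +oo%E.
    move=> Dinf; apply: nneseries_ge1_infty => // n.
    by have [k nk Dk] := Dinf n; exists k => //; rewrite uD// lee_fin.
  case: pselect => [H|nH].
    case: cid => /= n [taun _].
    have [Bw|nBw] := pselect (B w).
      by rewrite infty ?leey// => k; exists k => //; right.
    have invw : forall k, inv k (h k w).
      by apply: contrapT => ninv; apply: nBw; exact: subB.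
    apply: (@le_trans _ _ (u n w)).
      by rewrite uD ?lee_fin; [rewrite ler_wpDr//; exact: normp_le|left].
    by rewrite (nneseriesD1 (n := n))// leeDl// nneseries_ge0.
  (* Index 0 always qualifies since [0 <= t]; if no last index does, arbitrarily large ones do, and
     the series is infinite too. *)
  rewrite infty// => n; apply: contrapT => nk; apply: nH.
  have ex : exists k, (jump_time xi k w <= t%:E)%E.
    by exists 0%N; rewrite /jump_time big_geq// lee_fin.
  have ub k : (jump_time xi k w <= t%:E)%E -> (k <= n)%N.
    move=> tauk; rewrite leqNgt; apply/negP => nk'; apply: nk.
    by exists k; [exact: ltnW|left].
  by case: (ex_maxnP ex ub) => k tauk kmax; exists k.
rewrite integral_nneseries//; last first.
  move=> n; apply: emeasurable_funM => //.
  by apply/measurable_EFinP; exact: measurable_indic.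
have termE n : (\int[P]_w u n w = (a n)%:E * P (D n))%E.
  rewrite ge0_integralZl_EFin//; last first.
    by apply/measurable_EFinP; exact: measurable_indic.
  by rewrite integral_indic// setIT.
apply: (@le_lt_trans _ _ (((A + 1) * C * 2)%:E)); last exact: ltry.
apply: lime_le; first by apply: is_cvg_nneseries => n _ _; exact: integral_ge0.
apply: nearW => k.
apply: (@le_trans _ _ (((A + 1) * C) * \sum_(0 <= n < k) (n.+1%:R ^- 2))%:E);
  last by rewrite lee_fin ler_wpM2l ?sum_inv_sqr_le// mulr_ge0// addr_ge0.
rewrite mulr_sumr -sumEFin; apply: lee_sum => n _; rewrite termE.
apply: le_trans (lee_wpmul2l _ (PD n)) _; first by rewrite lee_fin.
rewrite -EFinM lee_fin.
apply: (@le_trans _ _ ((A + 1) * n.+1%:R ^+ p * (C / n.+1%:R ^+ p.+2))).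
  rewrite ler_wpM2r ?divr_ge0 ?exprn_ge0// /a mulrDl mul1r lerD2l.
  by rewrite exprn_ege1// ler1n.
rewrite le_eqVlt; apply/orP; left; apply/eqP.
have : n.+1%:R != 0 :> R by [].
move: (n.+1%:R) => x x0; have y0 : x ^+ p != 0 by rewrite expf_neq0.
rewrite -addn2 exprD; move: (x ^+ p) y0 => y y0.
by field; rewrite x0 y0.
Qed.

End Integrability.

(** * Finitely supported sums and their regrouping by target *)

Lemma fsum_seqE {R : realType} {I : choiceType} (S : set I) (X : seq I)
    (r : I -> R) : uniq X -> (forall x, x \notin X -> r x = 0) ->
  \sum_(x \in S) r x = \sum_(x <- X | x \in S) r x.
Proof.
move=> uX rX; rewrite (@fsbigE _ _ _ _ _ [seq x <- X | x \in S]).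
- by rewrite big_filter_cond; under eq_bigl do rewrite andbb.
- exact: filter_uniq.
- by move=> x /=; rewrite mem_filter => /andP[/set_mem].
- move=> x Sx; rewrite mem_filter negb_and => /orP[|/rX//].
  by rewrite mem_set.
Qed.

(** After exchanging the sums, each [x] is counted once, at its target [mv x], unless that target is
    [g]. This matches the sum of [ips_rate] with [ips_qtot]. *)
Lemma sum_fsum_target {R : realType} {I T : choiceType} (mv : I -> T) (r : I -> R)
    (X : seq I) (L : seq T) (g : T) :
  uniq X -> uniq L -> (forall x, x \notin X -> r x = 0) ->
  (forall x, x \in X -> mv x \in L) ->
  \sum_(g' <- L | g' != g) \sum_(x \in [set x | mv x = g']) r x =
  \sum_(x \in [set x | mv x <> g]) r x.
Proof.
move=> uX uL rX mvL; rewrite (fsum_seqE _ uX rX).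
under eq_bigr => g' _ do rewrite (fsum_seqE _ uX rX) big_mkcond.
rewrite exchange_big [RHS]big_mkcond/= [LHS]big_seq [RHS]big_seq.
apply: eq_bigr => x xX.
transitivity (\sum_(g' <- L | (g' == mv x) && (g' != g)) r x).
  rewrite [RHS]big_mkcond [LHS]big_mkcond; apply: eq_bigr => g' _.
  have -> : (x \in [set x | mv x = g']) = (g' == mv x).
    by apply/idP/eqP => [/set_mem/= ->//|->]; rewrite inE.
  by case: (g' == mv x); case: (g' != g).
have [xg|xg] := eqVneq (mv x) g.
  rewrite big1 => [|g' /andP[/eqP -> ]]; last by rewrite xg eqxx.
  by rewrite memNset.
rewrite mem_set; last exact/eqP.
rewrite big_mkcond (bigD1_seq (mv x)) ?mvL//= eqxx xg/= big1 ?addr0//.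
by move=> g' /negbTE ->.
Qed.

(** * Total mass and its growth under the moves *)

Section TotalMass.
Context {V E : countType} (src dst : E -> V) (V0 : set V).

(* Bounding all finite partial sums avoids sums over infinite index sets, and
   forces finite supports. *)
Definition mass_le (K : nat) (g : state V E) : Prop :=
  forall (sV : seq V) (sE : seq E), uniq sV -> uniq sE ->
    (\sum_(x <- sV) `|g.1 x| + \sum_(e <- sE) `|g.2 e| <= K)%N.

Lemma mass_leW K K' g : (K <= K')%N -> mass_le K g -> mass_le K' g.
Proof. by move=> KK' Kg sV sE uV uE; exact: leq_trans (Kg _ _ uV uE) KK'. Qed.

Lemma leq_sum_support {I : choiceType} (u : I -> nat) (s S : seq I) :
  uniq s -> uniq S -> (forall x, u x != 0 -> x \in S)%N ->
  (\sum_(x <- s) u x <= \sum_(x <- S) u x)%N.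
Proof.
move=> us uS uSupp.
rewrite (bigID (mem S))/= [X in (_ + X)%N]big1 ?addn0; last first.
  by move=> x xS; apply/eqP; apply: contraNT xS; exact: uSupp.
rewrite -big_filter [leqRHS](bigID (mem s))/= -[X in (_ <= X + _)%N]big_filter.
rewrite (perm_big [seq x <- S | x \in s]) ?leq_addr//=.
apply: uniq_perm; rewrite ?filter_uniq// => x.
by rewrite !mem_filter andbC.
Qed.

Lemma mass_le_F0 g : F0 g -> exists K, mass_le K g.
Proof.
move=> [/finite_seqP[sV sVE] /finite_seqP[sE sEE]].
exists (\sum_(x <- undup sV) `|g.1 x| + \sum_(e <- undup sE) `|g.2 e|)%N.
move=> tV tE uV uE; apply: leq_add; apply: leq_sum_support => //;
  rewrite ?undup_uniq// => x; rewrite absz_eq0 mem_undup => gx.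
  by have : [set` sV] x by rewrite -sVE.
by have : [set` sE] x by rewrite -sEE.
Qed.

(** An infinite support would contain [K.+1] points, each contributing at least 1. *)
Lemma finite_support_of_sum_le {I : choiceType} (u : I -> int) (K : nat) :
  (forall s, uniq s -> \sum_(x <- s) `|u x| <= K)%N ->
  finite_set [set x | u x != 0].
Proof.
move=> uK; apply: contrapT => /(infinite_set_fset K.+1)[B Bu].
apply/negP; rewrite -ltnNge ltnS.
apply: leq_trans (uK _ (finmap.fset_uniq B)).
rewrite -sum1_size [leqLHS]big_seq [leqRHS]big_seq; apply: leq_sum => x xB.
by rewrite lt0n absz_eq0; exact: (Bu x).
Qed.

Lemma F0_mass_le K g : mass_le K g -> F0 g.
Proof.
move=> Kg; split; apply: (@finite_support_of_sum_le _ _ K) => s us.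
  by have := Kg s [::] us isT; rewrite big_nil addn0.
by have := Kg [::] s isT us; rewrite big_nil add0n.
Qed.

(** Only edges at [x] change, each by at most 1, and a duplicate-free list holds at most [D] of
    them. *)
Lemma mass_le_node_move (D : nat) x K g :
  (forall s : seq E, uniq s ->
    (forall e, e \in s -> src e = x \/ dst e = x) -> (size s <= D)%N) ->
  mass_le K g -> mass_le (K + D) (node_move src dst x g).
Proof.
move=> degx Kg sV sE uV uE; apply: leq_trans (leq_add (Kg sV sE uV uE)
  (degx [seq e <- sE | (src e == x) || (dst e == x)] _ _)).
- rewrite -addnA leq_add2l size_filter -sum1_count [X in (_ <= _ + X)%N]big_mkcond.
  rewrite -big_split/=; apply: leq_sum => e _.
  by case: (src e == x); case: (dst e == x); case: sgzP => _ /=; lia.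
- exact: filter_uniq.
- by move=> e; rewrite mem_filter => /andP[/orP[]/eqP ->]; [left|right].
Qed.

(** Only the ends of [e] can change, each by at most 1, and each occurs at most once in a
    duplicate-free list. *)
Lemma mass_le_edge_move e K g :
  mass_le K g -> mass_le (K + 2) (edge_move src dst V0 e g).
Proof.
move=> Kg sV sE uV uE.
have cnt z : (count_mem z sV <= 1)%N by rewrite count_uniq_mem// leq_b1.
apply: leq_trans (leq_add (Kg sV sE uV uE) (leq_add (cnt (src e)) (cnt (dst e)))).
rewrite addnAC leq_add2r -!sum1_count (big_mkcond (pred1 _)).
rewrite [X in (_ <= _ + (_ + X))%N]big_mkcond -!big_split/=; apply: leq_sum => z _.
by case: (z == src e); case: (z == dst e); case: (z \in V0); case: sgzP => _ /=; lia.
Qed.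

End TotalMass.

Lemma fsum_le_seq {R : realType} {I : choiceType} (S : set I) (F : I -> R)
    (u : I -> nat) (c : R) : (forall x, F x <= c * (u x)%:R) ->
  \sum_(x \in S) F x <= c * (\sum_(x <- finite_support 0%R S F) u x)%N%:R.
Proof. by move=> Fu; rewrite natr_sum mulr_sumr; apply: ler_sum. Qed.

(** Both sums run along duplicate-free lists, which are what [mass_le] controls. *)
Lemma fsum_mass_le {R : realType} {V E : countType} (g : state V E) (K : nat)
    (A : set V) (B : set E) (F : V -> R) (G : E -> R) (c : R) :
  0 <= c -> mass_le K g -> (forall x, F x <= c * `|g.1 x|%:~R) ->
  (forall e, G e <= c * `|g.2 e|%:~R) ->
  \sum_(x \in A) F x + \sum_(e \in B) G e <= c * K%:R.
Proof.
move=> c0 Kg Fg Gg.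
have Fg' x : F x <= c * `|g.1 x|%N%:R by rewrite natr_absz.
have Gg' e : G e <= c * `|g.2 e|%N%:R by rewrite natr_absz.
apply: le_trans (lerD (fsum_le_seq A Fg') (fsum_le_seq B Gg')) _.
by rewrite -mulrDr -natrD ler_wpM2l// ler_nat; apply: Kg; exact: finite_support_uniq.
Qed.

Definition support_seq {I : choiceType} (u : I -> int) : seq I :=
  finmap.enum_fset (fset_set [set x | u x != 0]).

Lemma mem_support_seq {I : choiceType} (u : I -> int) x :
  finite_set [set x | u x != 0] -> (x \in support_seq u) = (u x != 0).
Proof.
move=> finu; rewrite [LHS]in_fset_set//.
by apply/idP/idP => [/set_mem//|ux]; exact: mem_set.
Qed.

Lemma support_seq_uniq {I : choiceType} (u : I -> int) : uniq (support_seq u).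
Proof. exact: finmap.fset_uniq. Qed.

(** * Jump kernel, rates and norms of the particle system *)

Section IPS.
Context {R : realType} {V E : countType} (src dst : E -> V) (V0 : set V)
  (m : V -> R) (k : E -> R).
Hypothesis m_pos : forall x, 0 < m x.
Hypothesis k_ge0 : forall e, 0 <= k e.

(** Moves outside the supports have rate 0. The state [g] itself is included because [ips_jump]
    stays there when the total rate is 0; [undup] is needed as different moves may share a
    target. *)
Definition ips_succ (g : state V E) : seq (state V E) :=
  undup (g :: [seq node_move src dst x g | x <- support_seq g.1] ++
              [seq edge_move src dst V0 e g | e <- support_seq g.2]).

Lemma sum_ips_jump g : F0 g ->
  \sum_(g' <- ips_succ g) ips_jump src dst V0 m k g g' = 1.
Proof.
move=> [finV finE].
have uL : uniq (ips_succ g) by exact: undup_uniq.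
have gL : g \in ips_succ g by rewrite mem_undup inE eqxx.
have as_eq (g' : state V E) : `[< g' = g >] = (g' == g).
  exact/(sameP (asboolP _))/eqP.
rewrite /ips_jump; have [q0|q0] := eqVneq (ips_qtot src dst V0 m k g) 0.
  rewrite (bigD1_seq g)//= as_eq eqxx big1 ?addr0// => g' g'g.
  by rewrite as_eq (negbTE g'g).
transitivity (\sum_(g' <- ips_succ g | g' != g)
    ips_rate src dst V0 m k g g' / ips_qtot src dst V0 m k g).
  rewrite [RHS]big_mkcond; apply: eq_bigr => g' _.
  by rewrite as_eq; case: (g' == g).
rewrite -mulr_suml /ips_rate big_split/=.
rewrite (@sum_fsum_target R V (state V E) _ _ (support_seq g.1)) ?support_seq_uniq//; last 2 first.
- by move=> x; rewrite mem_support_seq// negbK => /eqP ->; rewrite normr0 mul0r.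
- by move=> x xs; rewrite mem_undup inE mem_cat (map_f (node_move src dst ^~ g) xs) ?orbT.
rewrite (@sum_fsum_target R E (state V E) _ _ (support_seq g.2)) ?support_seq_uniq//; last 2 first.
- by move=> e; rewrite mem_support_seq// negbK => /eqP ->; rewrite normr0 mulr0.
- by move=> e es; rewrite mem_undup inE mem_cat (map_f (edge_move src dst V0 ^~ g) es) ?orbT.
by rewrite -/(ips_qtot src dst V0 m k g) divff.
Qed.

Lemma mass_le_ips_succ (D K : nat) g g' :
  (forall (x : V) (s : seq E), uniq s ->
    (forall e, e \in s -> src e = x \/ dst e = x) -> (size s <= D)%N) ->
  mass_le K g -> g' \in ips_succ g -> mass_le (K + (D + 2)) g'.
Proof.
move=> deg Kg; rewrite mem_undup inE mem_cat => /or3P[/eqP ->|/mapP[x _ ->]|/mapP[e _ ->]].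
- by apply: mass_leW Kg; rewrite leq_addr.
- apply: mass_leW (mass_le_node_move (deg x) Kg).
  by rewrite leq_add2l leq_addr.
- apply: mass_leW (mass_le_edge_move src dst V0 e Kg).
  by rewrite leq_add2l leq_addl.
Qed.

Context (M : R).
Hypothesis M_ge0 : 0 <= M.
Hypothesis m_inv_le : forall x, (m x)^-1 <= M.
Hypothesis k_le : forall e, k e <= M.

Lemma ips_qtot_le K g : mass_le K g -> ips_qtot src dst V0 m k g <= M * K%:R.
Proof.
move=> Kg; apply: (fsum_mass_le _ _ M_ge0 Kg) => [x|e].
  by rewrite mulrC ler_wpM2r// ler0z.
by rewrite ler_wpM2r// ler0z.
Qed.

(** One factor of the power stays linear, to be summed by the mass; the others are bounded
    uniformly. The base [K.+1] is at least 1, so its exponent may be raised to [p]. *)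
Lemma powR_le_mass (K p : nat) (alpha : R) (z : int) :
  1 <= alpha -> alpha - 1 <= p%:R -> (`|z| <= K)%N ->
  `|z|%:~R `^ alpha <= K.+1%:R ^+ p * `|z|%:~R :> R.
Proof.
move=> al1 alp zK; have a0 : 0 <= `|z|%:~R :> R by rewrite ler0z.
rewrite -mulr_powRB1 ?(lt_le_trans ltr01)// mulrC ler_wpM2r//.
rewrite -powR_mulrn//; apply: (@le_trans _ _ (K.+1%:R `^ (alpha - 1))).
  apply: ge0_ler_powR; rewrite ?subr_ge0 ?nnegrE//.
  by rewrite -natr_absz ler_nat ltnW.
by apply: ler_powR => //; rewrite ler1n.
Qed.

(** [mass_le] on one-element lists bounds each value by [K], as [powR_le_mass] requires. *)
Lemma ips_normp_le (K p : nat) (alpha : R) g :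
  1 <= alpha -> alpha - 1 <= p%:R -> mass_le K g ->
  ips_normp m k alpha g <= M * K.+1%:R ^+ p * K%:R.
Proof.
move=> al1 alp Kg.
have c0 : 0 <= M * K.+1%:R ^+ p by rewrite mulr_ge0// exprn_ge0.
apply: (fsum_mass_le _ _ c0 Kg) => [x|e]; rewrite -mulrA.
  rewrite mulrC; apply: ler_pM; rewrite ?powR_ge0//.
    by rewrite invr_ge0 ltW.
  apply: powR_le_mass => //; have := Kg [:: x] [::] isT isT.
  by rewrite big_seq1 big_nil addn0.
apply: ler_pM; rewrite ?powR_ge0//.
apply: powR_le_mass => //; have := Kg [::] [:: e] isT isT.
by rewrite big_seq1 big_nil add0n.
Qed.

Lemma ips_normp_ge0 (alpha : R) g : 0 <= ips_normp m k alpha g.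
Proof.
apply: addr_ge0; apply: sumr_ge0 => x _.
  by rewrite divr_ge0 ?powR_ge0// ltW.
by rewrite mulr_ge0 ?powR_ge0.
Qed.

End IPS.

Theorem theorem2p2 (R : realType) (V E : countType) (src dst : E -> V)
  (V0 : set V) (m : V -> R) (k : E -> R)
  (no_loop : forall e, src e <> dst e)
  (simple : forall e e', (src e = src e' /\ dst e = dst e') \/
                         (src e = dst e' /\ dst e = src e') -> e = e')
  (deg_bdd : exists D : nat, forall (x : V) (s : seq E), uniq s ->
               (forall e, e \in s -> src e = x \/ dst e = x) -> (size s <= D)%N)
  (m_pos : forall x, 0 < m x) (k_ge0 : forall e, 0 <= k e)
  (M_fin : exists M : R, (forall x, (m x)^-1 <= M) /\ (forall e, k e <= M))
  (d : measure_display) (Omega : measurableType d) (P : probability Omega R)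
  (f : state V E) (h : nat -> Omega -> state V E) (xi : nat -> Omega -> \bar R)
  (t alpha : R) :
  F0 f -> 0 <= t -> 1 <= alpha ->
  is_IPS src dst V0 m k P f h xi ->
  (\int[P]_w ips_normp_at h xi (ips_normp m k alpha) t w < +oo)%E.
Proof.
move=> /mass_le_F0[K0 K0f] t_ge0 al1 law.
have [D degD] := deg_bdd; have [M0 [mM0 kM0]] := M_fin.
(* On an empty graph [M0] may be negative. *)
pose M : R := `|M0|; have M_ge0 : 0 <= M by exact: normr_ge0.
have mM x : (m x)^-1 <= M by exact: le_trans (mM0 x) (ler_norm _).
have kM e : k e <= M by exact: le_trans (kM0 e) (ler_norm _).
(* A node move adds at most [D] to the mass and an edge move at most 2. *)
pose c := (D + 2)%N; pose inv n := @mass_le V E (K0 + c * n).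
have K_le n : (K0 + c * n <= (K0 + c) * n.+1)%N by rewrite mulnSr mulnDl; nia.
pose p := (Num.trunc alpha).+1.
have alp : alpha - 1 <= p%:R by have := truncnS_gt alpha; rewrite -/p; lra.
have invS n g g' : inv n g -> g' \in ips_succ src dst V0 g -> inv n.+1 g'.
  by rewrite /inv mulnSr addnA => /(mass_le_ips_succ degD) => /[apply].
have sum_pi n g : inv n g ->
    \sum_(x <- ips_succ src dst V0 g) ips_jump src dst V0 m k g x = 1.
  by move=> /F0_mass_le/sum_ips_jump.
have inv0 : inv 0%N f by rewrite /inv muln0 addn0.
(* The summand 1 keeps [L] positive even if [M = 0]. *)
pose L : R := M * (K0 + c)%:R + 1.
have L_gt0 : 0 < L by rewrite ltr_wpDl// mulr_ge0.
apply: (@integral_ips_normp_at_lty R V E d Omega P f _ _ h xi law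
  (ips_succ src dst V0) inv inv0 invS _ sum_pi L L_gt0 _ _
  (M * (K0 + c).+1%:R ^+ p * (K0 + c)%:R) t p.+1) => //.
- by move=> g; exact: undup_uniq.
- move=> n g /(ips_qtot_le src dst V0 M_ge0 mM kM) /le_trans; apply.
  rewrite /L mulrDl -mulrA -natrM ler_wpDr// ?mul1r// ler_wpM2l// ler_nat.
  exact: K_le.
- by rewrite !mulr_ge0// exprn_ge0.
- exact: ips_normp_ge0.
move=> n g /(ips_normp_le m_pos k_ge0 M_ge0 mM kM al1 alp) /le_trans; apply.
(* The mass and its successor are both at most a constant times [n.+1], whence the degree [p.+1]. *)
have -> : M * (K0 + c).+1%:R ^+ p * (K0 + c)%:R * n.+1%:R ^+ p.+1 =
    M * ((K0 + c).+1 * n.+1)%:R ^+ p * ((K0 + c) * n.+1)%:R.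
  by rewrite !natrM exprMn exprSr; ring.
apply: ler_pM; rewrite ?mulr_ge0 ?exprn_ge0 ?ler_nat//.
rewrite ler_wpM2l// lerXn2r ?nnegrE// ler_nat mulSn.
by rewrite -addn1 addnC leq_add.
Qed.
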